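(* Let $P \supseteq I$ be ideals of a semiring $S$, where $P$ is prime. Then the following statements are equivalent: (1) $P$ is a minimal prime ideal of $I$. (2) $S\setminus P$ is an MC-set that is maximal (with respect to inclusion, among MC-sets) with respect to being disjoint from $I$. (3) For each $x\in P$, there is a $y\in S$ with $y\notin P$ and a nonnegative integer $i$ such that $yx^i \in I$.
   Context: A semiring is a set $S$ with operations $+,\cdot$ such that $(S,+)$ is a commutative monoid with identity $0$, $(S,\cdot)$ is a commutative monoid with identity $1\neq 0$, multiplication distributes over addition, and $s\cdot 0=0$ for all $s\in S$. A nonempty subset $I\subseteq S$ is an ideal if $a+b\in I$ and $sa\in I$ for all $a,b\in I$, $s\in S$. An ideal $P\neq S$ is prime if $ab\in P$ implies $a\in P$ or $b\in P$. A minimal prime ideal of an ideal $I$ is an inclusion-minimal element of the set of prime ideals of $S$ containing $I$. An MC-set (multiplicatively closed set) is a subset $W\subseteq S$ with $1\in W$ and $w_1w_2\in W$ for all $w_1,w_2\in W$. *)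

(* Defs.v *)
From HB Require Import structures.
From mathcomp Require Import all_boot all_order all_algebra.
From mathcomp Require Import boolp classical_sets.
Set Implicit Arguments.
Unset Strict Implicit.
Unset Printing Implicit Defensive.
Import GRing.Theory.
Local Open Scope classical_set_scope.
Local Open Scope ring_scope.

(* The ideal predicates of ring_quotient need additive inverses and boolean
   membership, so they do not apply to arbitrary subsets of a semiring. *)

Definition is_ideal (S : comNzSemiRingType) (I : set S) : Prop :=
  [/\ I !=set0,
      forall a b, I a -> I b -> I (a + b) &
      forall s a, I a -> I (s * a)].

Definition is_prime_ideal (S : comNzSemiRingType) (P : set S) : Prop :=
  [/\ is_ideal P, P <> setT & forall a b, P (a * b) -> P a \/ P b].

Definition is_minimal_prime_of (S : comNzSemiRingType) (I P : set S) : Prop :=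
  [/\ is_prime_ideal P, I `<=` P &
      forall Q : set S, is_prime_ideal Q -> I `<=` Q -> Q `<=` P -> Q = P].

Definition is_MC_set (S : comNzSemiRingType) (W : set S) : Prop :=
  W 1 /\ forall w1 w2, W w1 -> W w2 -> W (w1 * w2).

Definition is_maximal_MC_set_disjoint_from
    (S : comNzSemiRingType) (I W : set S) : Prop :=
  [/\ is_MC_set W, W `&` I = set0 &
      forall V : set S, is_MC_set V -> V `&` I = set0 -> W `<=` V -> V = W].

(* Main.v *)
(* The passage from (1) to (2) is Krull's lemma: an ideal
   containing I and maximal among those disjoint from an MC-set V is prime,
   and its proof only expands (q + s a)(q' + s' b), so it needs no additive
   inverses.  If V contains S \ P, this prime lies in P, hence is P by
   minimality.  For (2) => (3), maximality is applied to the MC-set generated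
   by S \ P and x. *)
Require Import Defs.
From HB Require Import structures.
From mathcomp Require Import all_boot all_order all_algebra.
From mathcomp Require Import boolp classical_sets.
Set Implicit Arguments.
Unset Strict Implicit.
Unset Printing Implicit Defensive.
Import GRing.Theory.
Local Open Scope classical_set_scope.
Local Open Scope ring_scope.

Lemma ideal0 (S : comNzSemiRingType) (J : set S) : is_ideal J -> J 0.
Proof. by move=> [[a Ja] _ JM]; rewrite -(mul0r a); exact: JM. Qed.

Lemma prime_ideal_not1 (S : comNzSemiRingType) (P : set S) :
  is_prime_ideal P -> ~ P 1.
Proof.
move=> [[_ _ PM] PT _] P1; apply: PT; apply/seteqP; split=> // x _.
by rewrite -(mulr1 x); exact: PM.
Qed.

(** The base case [n = 0] is vacuous because 1 lies outside a prime ideal; this covers the exponent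
    0 permitted in (3). *)
Lemma prime_idealX (S : comNzSemiRingType) (P : set S) x n :
  is_prime_ideal P -> P (x ^+ n) -> P x.
Proof.
move=> hP; elim: n => [|n IHn]; first by rewrite expr0 => /(prime_ideal_not1 hP).
by case: hP => _ _ PP; rewrite exprS => /PP [].
Qed.

Lemma prime_ideal_MC_setC (S : comNzSemiRingType) (P : set S) :
  is_prime_ideal P -> is_MC_set (~` P).
Proof.
move=> hP; split; first exact: prime_ideal_not1.
by case: hP => _ _ PP a b Pa Pb /PP [].
Qed.

Lemma is_ideal_adjoin (S : comNzSemiRingType) (J : set S) (a : S) :
  is_ideal J -> is_ideal [set x | exists q s, J q /\ x = q + s * a].
Proof.
move=> hJ; have [_ JD JM] := hJ; split.
- by exists 0, 0, 0; rewrite mul0r addr0; split=> //; exact: ideal0.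
- move=> _ _ [q [s [Jq ->]]] [r [t [Jr ->]]]; exists (q + r), (s + t).
  by split; [exact: JD | rewrite mulrDl addrACA].
- move=> t _ [q [s [Jq ->]]]; exists (t * q), (t * s).
  by split; [exact: JM | rewrite mulrDr mulrA].
Qed.

(** If [a] and [b] lie outside [J], the ideals J + Sa and J + Sb are strictly larger than [J], so
    both meet [V]. The product of the two meeting points stays in [V], yet falls into [J] as soon as
    [a * b] does. *)
Lemma maximal_disjoint_ideal_prime (S : comNzSemiRingType) (J V : set S) :
  is_MC_set V -> is_ideal J -> V `&` J = set0 ->
  (forall K, is_ideal K -> V `&` K = set0 -> J `<=` K -> K `<=` J) ->
  is_prime_ideal J.
Proof.
move=> [V1 VM] hJ VJ0 Jmax; have [_ JD JM] := hJ.
have disj v : V v -> ~ J v by move=> Vv Jv; rewrite -[False]/(set0 v) -VJ0.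
have meet a : ~ J a -> exists q s, J q /\ V (q + s * a).
  move=> nJa; apply: contrapT => nmeet; apply: nJa.
  apply: (Jmax _ (is_ideal_adjoin a hJ)).
  - rewrite -subset0 => x [Vx [q [s [Jq xE]]]].
    by apply: nmeet; exists q, s; rewrite -xE.
  - by move=> q Jq; exists q, 0; rewrite mul0r addr0.
  - by exists 0, 1; rewrite mul1r add0r; split=> //; exact: ideal0.
split=> //; first by move=> JT; apply: (disj _ V1); rewrite JT.
move=> a b Jab; apply: contrapT => /not_orP [/meet [q [s [Jq Va]]]].
move=> /meet [r [t [Jr Vb]]]; apply: (disj _ (VM _ _ Va Vb)).
(* The terms with a factor [q] or [r] are in [J]; the remaining one regroups as
   [(s * t) * (a * b)]. *)
rewrite mulrDl; apply: (JD); first by rewrite mulrC; apply: JM.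
by rewrite mulrDr mulrACA; apply: JD; apply: JM.
Qed.

Lemma exists_prime_ideal_disjoint (S : comNzSemiRingType) (I V : set S) :
  is_ideal I -> is_MC_set V -> V `&` I = set0 ->
  exists Q, [/\ is_prime_ideal Q, I `<=` Q & V `&` Q = set0].
Proof.
move=> hI hV VI0.
(* Joining I to each set makes the empty chain harmless in Zorn's lemma. *)
pose good (A : set S) := is_ideal (A `|` I) /\ V `&` (A `|` I) = set0.
have [F Fgood Ftot|A [[hA VA0] Amax]] := @Zorn_bigcup S good.
  have [[x0 Ix0] ID IM] := hI.
  have incl A : F A -> A `|` I `<=` \bigcup_(X in F) X `|` I.
    by move=> FA x [Ax|Ix]; [left; exists A | right].
  split; first split.
  - by exists x0; right.
  - move=> a b [[A FA Aa]|Ia] [[B FB Bb]|Ib]; last by right; exact: ID.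
    (* Two elements from different members of the chain both lie in the larger member, where their
       sum can be formed. *)
    + have [AB|BA] := Ftot _ _ FA FB.
      * have [[_ BD _] _] := Fgood _ FB.
        by apply: (incl _ FB); apply: BD; left=> //; exact: AB.
      * have [[_ AD _] _] := Fgood _ FA.
        by apply: (incl _ FA); apply: AD; left=> //; exact: BA.
    + have [[_ AD _] _] := Fgood _ FA.
      by apply: (incl _ FA); apply: AD; [left | right].
    + have [[_ BD _] _] := Fgood _ FB.
      by apply: (incl _ FB); apply: BD; [right | left].
  - move=> s a [[A FA Aa]|Ia]; last by right; exact: IM.
    have [[_ _ AM] _] := Fgood _ FA.
    by apply: (incl _ FA); apply: AM; left.
  - rewrite -subset0 => x [Vx [[A FA Ax]|Ix]]; last by rewrite -VI0.
    by have [_ <-] := Fgood _ FA; split=> //; left.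
exists (A `|` I); split=> //; apply: (maximal_disjoint_ideal_prime hV) => //.
(* Since [K] contains [I], its union with [I] is [K] itself, so [K] is [good]; it strictly contains
   [A], as otherwise it would lie in the union of [A] and [I]. *)
move=> K hK VK0 AIK; apply: contrapT => nKAI; apply: (Amax K).
  split; first by move=> x Ax; apply: AIK; left.
  by move=> KA; apply: nKAI => x /KA; left.
by rewrite /good setUidl// => x Ix; apply: AIK; right.
Qed.

Theorem theorem3p5 (S : comNzSemiRingType) (I P : set S)
    (hI : is_ideal I) (hP : is_prime_ideal P) (hIP : I `<=` P) :
  [<-> is_minimal_prime_of I P;
       is_maximal_MC_set_disjoint_from I (~` P);
       forall x, P x -> exists y i, ~ P y /\ I (y * x ^+ i)].
Proof.
have [P1 PM] := prime_ideal_MC_setC hP.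
tfae.
- move=> [_ _ Pmin]; split; first exact: prime_ideal_MC_setC.
    by rewrite -subset0 => x [nPx /hIP].
  move=> V hV VI0 PV; apply/seteqP; split=> // v Vv Pv.
  have [Q [hQ IQ VQ0]] := exists_prime_ideal_disjoint hI hV VI0.
  have QP : Q `<=` P.
    by move=> x Qx; apply: contrapT => /PV Vx; rewrite -[False]/(set0 x) -VQ0.
  by rewrite -[False]/(set0 v) -VQ0 (Pmin _ hQ IQ QP).
- move=> [_ _ Wmax] x Px; apply: contrapT => nIx.
  (* If (3) fails at [x], this MC-set is disjoint from [I]. Exponent 0 recovers the complement of
     [P], while [y = 1], [i = 1] gives [x], which is in [P]. *)
  pose V := [set z | exists y i, ~ P y /\ z = y * x ^+ i].
  have VE : V = ~` P.
    apply: Wmax.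
    + split; first by exists 1, 0%N; rewrite expr0 mulr1.
      move=> _ _ [y [i [Py ->]]] [z [j [Pz ->]]]; exists (y * z), (i + j)%N.
      by split; [exact: PM | rewrite exprD mulrACA].
    + rewrite -subset0 => z [[y [i [Py zE]]] Iz].
      by apply: nIx; exists y, i; rewrite -zE.
    + by move=> y Py; exists y, 0%N; rewrite expr0 mulr1.
  suff: V x by rewrite VE.
  by exists 1, 1%N; rewrite mul1r expr1.
(* For a prime [Q] between [I] and [P], the product [y * x ^+ i] is in [Q] but [y] is not, so a
   power of [x], and hence [x], is in [Q]. *)
- move=> H; split=> // Q hQ IQ QP; apply/seteqP; split=> // x /H.
  move=> [y [i [nPy /IQ]]]; have [_ _ QQ] := hQ.
  by case/QQ => [/QP //|]; exact: prime_idealX.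
Qed.
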